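(* Let $\ell\in\mathbb{N}$ and let $v(x)=\sum_{j=1}^{\ell}a_jx^{2j-1}$ be an odd real polynomial ($a_1,\dots,a_\ell\in\mathbb{R}$). Then for every non-principal ultrafilter $p\in\beta\mathbb{N}$, $$\operatorname{p_\ell-lim}_{n\in\mathbb{N}} v(n)=0 \quad\text{in } \mathbb{T}=\mathbb{R}/\mathbb{Z}.$$ Equivalently, for every $\epsilon>0$ the set $\mathcal R(v,\epsilon)=\{n\in\mathbb{N}\,:\,\|v(n)\|<\epsilon\}$ is a $\Delta_\ell^*$ set.
   Context: $\mathbb{N}=\{1,2,\dots\}$ and $\|x\|$ denotes the distance from $x\in\mathbb{R}$ to the nearest integer; $v(n)$ is regarded as an element of $\mathbb{T}=\mathbb{R}/\mathbb{Z}$. $\beta\mathbb{N}$ is the set of ultrafilters on $\mathbb{N}$. For a non-principal ultrafilter $p$, $-p+p$ is the ultrafilter defined by: $A\in -p+p$ iff $\{n\in\mathbb{N}: n+A\in p\}\in p$, where $n+A=\{n+a:a\in A\}$. Set $p_0=p$ and $p_\ell=-p_{\ell-1}+p_{\ell-1}$ for $\ell\ge1$. For a sequence $(x_n)$ in a compact Hausdorff space $X$, $\operatorname{p-lim}_{n} x_n=x$ means that for every neighbourhood $U$ of $x$, $\{n: x_n\in U\}\in p$. Define $\partial:\bigcup_{\ell\ge1}\mathbb{Z}^{2^\ell}\to\mathbb{Z}$ recursively by $\partial(m_1,m_2)=m_2-m_1$ and $\partial(m_1,\dots,m_{2^\ell})=\partial(m_{2^{\ell-1}+1},\dots,m_{2^\ell})-\partial(m_1,\dots,m_{2^{\ell-1}})$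 for $\ell>1$. A set $E\subseteq\mathbb{N}$ is $\Delta_\ell^*$ if for every increasing sequence $(n_k)_{k\in\mathbb{N}}$ in $\mathbb{N}$ there exist $k_1<k_2<\dots<k_{2^\ell}$ with $\partial(n_{k_1},\dots,n_{k_{2^\ell}})\in E$. *)

(* Defs.v *)
From HB Require Import structures.
From mathcomp Require Import all_boot all_order all_algebra.
From mathcomp Require Import all_classical all_reals all_analysis.

Set Implicit Arguments.
Unset Strict Implicit.
Unset Printing Implicit Defensive.

Import Order.TTheory GRing.Theory Num.Theory.
Import numFieldNormedType.Exports.
Local Open Scope classical_set_scope.
Local Open Scope ring_scope.
Local Open Scope quotient_scope.

Notation posnat := {n : nat | (0 < n)%N}.

Definition translate (n : posnat) (A : set posnat) : set posnat :=
  [set m | exists2 a, A a & val m = (val n + val a)%N].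

(* The ultrafilter -p+p, for p a nonprincipal ultrafilter. *)
Definition self_diff (p : set_system posnat) : set_system posnat :=
  [set A | p [set n | p (translate n A)]].

Definition iter_diff (l : nat) (p : set_system posnat) : set_system posnat :=
  iter l self_diff p.

Definition nonprincipal (p : set_system posnat) : Prop :=
  ~ exists n, p = principal_filter n.

Definition RmodZ (R : realType) :=
  {ideal_quot (GRing.ZmodClosed.clone R (@Num.int_num_subdef R) _)}.

(* R/Z, with the quotient topology of R. *)
Definition circle (R : realType) : topologicalType :=
  quotient_topology (RmodZ R).

Definition to_circle (R : realType) (x : R) : circle R :=
  \pi_(quotient_topology (RmodZ R)) x.

Lemma to_circleP (R : realType) (x y : R) :
  to_circle x = to_circle y <-> x - y \is a Num.int.
Proof.
have -> : (x - y \is a Num.int) = (x == y %[mod RmodZ R]).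
  by rewrite -Quotient.idealrBE.
by split => [e|/eqP e]; [apply/eqP|]; exact: e.
Qed.

Definition dist_int (R : realType) (x : R) : R :=
  inf [set `|x - m%:~R| | m in [set: int]].

Definition odd_polynomial (R : realType) (l : nat) (a : nat -> R) : {poly R} :=
  \sum_(1 <= j < l.+1) a j *: 'X^(2 * j - 1).

(* The alternating map on Z^(2^l), meaningful when size m = 2 ^ l. The
   convention for l = 0 makes the l = 1 case [:: m1; m2] |-> m2 - m1. *)
Fixpoint partial_diff (l : nat) (m : seq int) : int :=
  if l is l'.+1 then
    partial_diff l' (drop (2 ^ l') m) - partial_diff l' (take (2 ^ l') m)
  else head 0 m.

Definition Delta_star (l : nat) (E : set posnat) : Prop :=
  forall n : nat -> posnat,
    {homo n : i j / (i < j)%N >-> (val i < val j)%N} ->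
    exists k : (2 ^ l).-tuple nat,
      sorted ltn k /\
      exists2 e, E e &
        (val e)%:Z = partial_diff l [seq (val (n i))%:Z | i <- k].

(* Main.v *)
Require Import Defs.
From HB Require Import structures.
From mathcomp Require Import all_boot all_order all_algebra.
From mathcomp Require Import all_classical all_reals all_analysis.
From mathcomp Require Import ring lra zify.
Import Order.TTheory GRing.Theory Num.Theory.
Import numFieldNormedType.Exports.
Local Open Scope classical_set_scope.
Local Open Scope ring_scope.

(** Write [q = p_(l-1)], so that a [p_l]-limit of [f] is the iterated [q]-limit,
first in [m] and then in [n], of [f (m - n)].  Expand [c (m - n)^d] for an odd
[d <= 2l - 1].  The outer terms [c m^d - c n^d] have the same [q]-limit in [R/Z]
(which exists by compactness) and cancel.  In a cross term [c' m^i n^j] exactly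
one of [i], [j] is odd, and it is at most [2l - 3]: if it is [i], the [m]-limit
vanishes by induction; if it is [j], the [m]-limit is [L n^j], where [L] is the
limit of [c' m^i], and the [n]-limit vanishes by induction.

For the combinatorial form, apply this to the image [p] under [k |-> n_k] of a
free ultrafilter on the indices: a set in [p_l] contains some
[partial_diff l (n_k1, ...)] with indices beyond any given bound. *)

(** * Ultrafilters *)

Lemma ultra_of_setVsetC (T : Type) (F : set_system T) :
  ProperFilter F -> (forall A, F A \/ F (~` A)) -> UltraFilter F.
Proof.
move=> PF FVC; split=> // G PG FG; rewrite eqEsubset; split=> // A GA.
have [//|/FG GAC] := FVC A.
have G0 : G set0 by rewrite -(setICr A); exact: filterI.
by case: (filter_not_empty G G0).
Qed.

Lemma ultra_fmap (T U : Type) (f : T -> U) (F : set_system T) :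
  UltraFilter F -> UltraFilter (f @ F).
Proof.
move=> UF; have PF := @ultra_proper _ _ UF.
apply: ultra_of_setVsetC => A.
exact: (in_ultra_setVsetC (f @^-1` A) UF).
Qed.

(** The form of non-principality that survives passing to [self_diff] and that allows assuming
    [n < m] in the inner limit. *)
Definition free_filter (q : set_system posnat) : Prop :=
  forall K : nat, q [set n | (K < val n)%N].

Lemma nonprincipal_free (p : set_system posnat) :
  UltraFilter p -> nonprincipal p -> free_filter p.
Proof.
move=> Up np; have Pp := @ultra_proper _ _ Up; elim=> [|K IH].
  by apply: filterS filterT => -[n n0].
(* Going from [K] to [K.+1] removes only the point [K.+1]; an ultrafilter containing a singleton is
   principal. *)
pose k : posnat := exist _ K.+1 (ltn0Sn K).
have [pk|pk] := in_ultra_setVsetC [set k] Up.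
  case: np; exists k; rewrite eqEsubset; split=> A.
    move=> pA n /= ->; have [m [/= -> //]] := filter_ex (filterI pk pA).
  by move=> kA; apply: filterS pk.
apply: filterS (filterI IH pk) => n [/= Kn nk].
rewrite ltn_neqAle Kn andbT; apply/eqP => e.
by apply: nk; apply: val_inj.
Qed.

Lemma posnat_ltP (n m : posnat) : (val n < val m)%N ->
  exists a : posnat, val m = (val n + val a)%N.
Proof.
move=> nm; have mn0 : (0 < val m - val n)%N by rewrite subn_gt0.
by exists (exist _ (val m - val n)%N mn0); rewrite /= subnKC// ltnW.
Qed.

Lemma self_diff_ultra (q : set_system posnat) :
  UltraFilter q -> free_filter q -> UltraFilter (self_diff q).
Proof.
move=> Uq fq; have Pq := @ultra_proper _ _ Uq.
have translateT n A B : (forall a, A a \/ B a) ->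
    [set m | (val n < val m)%N] `<=` translate n A `|` translate n B.
  move=> AB m /posnat_ltP[d md].
  by case: (AB d) => ABd; [left|right]; exists d.
have Fd : Filter (self_diff q).
  apply: Build_Filter.
  - rewrite /self_diff /=; apply: filterS filterT => n _ /=.
    apply: filterS (fq (val n)) => m nm.
    by case: (translateT n setT setT (fun=> or_introl I) m nm).
  - move=> A B qA qB; rewrite /self_diff /=.
    apply: filterS (@filterI _ q _ _ _ qA qB) => n [/= nA nB].
    apply: filterS (filterI nA nB) => m [[a Aa ea] [b Bb eb]].
    exists a => //; split => //.
    by have -> : a = b by apply: val_inj; apply: (@addnI (val n)); rewrite -ea -eb.
  - move=> A B AB; rewrite /self_diff /=; apply: filterS => n /=.
    by apply: filterS => m [a Aa ea]; exists a => //; exact: AB.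
have Pd : ProperFilter (self_diff q).
  apply: Build_ProperFilter => q0.
  have [n /= qn] := @filter_ex _ q _ _ q0.
  by have [m [a]] := filter_ex qn.
apply: ultra_of_setVsetC => A; rewrite /self_diff /=.
have [|qA] := in_ultra_setVsetC [set n | q (translate n A)] Uq; first by left.
right; apply: filterS qA => n /= nA.
have [//|nA'] := in_ultra_setVsetC (translate n A) Uq.
apply: filterS (filterI (fq (val n)) nA') => m [nm nAm].
by case: (translateT n A (~` A) (fun a => EM (A a)) m nm).
Qed.

Lemma self_diff_free (q : set_system posnat) :
  Filter q -> free_filter q -> free_filter (self_diff q).
Proof.
move=> Fq fq K; rewrite /self_diff /=; apply: filterS filterT => n _ /=.
apply: filterS (fq (val n + K)%N) => m nm.
have [d md] := posnat_ltP n m (leq_ltn_trans (leq_addr K _) nm).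
by exists d => //; move: nm; rewrite /= md ltn_add2l.
Qed.

Lemma iter_diff_ultra_free (l : nat) (p : set_system posnat) :
  UltraFilter p -> free_filter p ->
  UltraFilter (iter_diff l p) /\ free_filter (iter_diff l p).
Proof.
move=> Up fp; elim: l => [//|l [Uq fq]]; rewrite /iter_diff /=; split.
  exact: self_diff_ultra.
by apply: self_diff_free => //; have := @ultra_proper _ _ Uq => -[].
Qed.

(** * Distance to the nearest integer *)

Section dist_int_theory.
Variable R : realType.
Implicit Types x y e : R.

Lemma dist_int_ltP x e :
  dist_int x < e <-> exists m : int, `|x - m%:~R| < e.
Proof.
split=> [xe|[m xm]].
  have [|_ [m _ <-] xm] := inf_lt _ xe; last by exists m.
  by exists `|x - 0%:~R|, 0.
apply: le_lt_trans xm; apply: ge_inf; last by exists m.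
by exists 0 => _ [k _ <-].
Qed.

Lemma dist_int_ltD x y e1 e2 :
  dist_int x < e1 -> dist_int y < e2 -> dist_int (x + y) < e1 + e2.
Proof.
move=> /dist_int_ltP[m xm] /dist_int_ltP[k yk]; apply/dist_int_ltP.
exists (m + k); rewrite intrD opprD addrACA.
exact: le_lt_trans (ler_normD _ _) (ltrD xm yk).
Qed.

Lemma dist_int_ltN x e : dist_int x < e -> dist_int (- x) < e.
Proof.
move=> /dist_int_ltP[m xm]; apply/dist_int_ltP; exists (- m).
by rewrite mulrNz -opprD normrN.
Qed.

(** Multiplication by an integer is well defined on R/Z and stretches distances at most [k]
    times. *)
Lemma dist_int_ltMn (k : nat) x e :
  (0 < k)%N -> dist_int x < e / k%:R -> dist_int (k%:R * x) < e.
Proof.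
move=> k0 /dist_int_ltP[m xm]; apply/dist_int_ltP; exists (k%:Z * m).
rewrite intrM -mulrBr normrM ger0_norm ?ler0n// mulrC -ltr_pdivlMr//.
by rewrite ltr0n.
Qed.

End dist_int_theory.

(** * Limits modulo 1 along a filter *)

Section limits_mod1.
Variable R : realType.

Definition cvg0_mod1 (q : set_system posnat) (f : posnat -> R) : Prop :=
  forall e : R, 0 < e -> q [set n | dist_int (f n) < e].

(* The inner limit is in the second variable of [F]. *)
Definition cvg20_mod1 (q : set_system posnat) (F : posnat -> posnat -> R) : Prop :=
  forall e : R, 0 < e -> q [set n | q [set m | dist_int (F n m) < e]].

Lemma cvg0_mod1D (q : set_system posnat) (f g : posnat -> R) : Filter q ->
  cvg0_mod1 q f -> cvg0_mod1 q g -> cvg0_mod1 q (fun n => f n + g n).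
Proof.
move=> Fq qf qg e e0; have e20 : 0 < e / 2 by lra.
apply: filterS (filterI (qf _ e20) (qg _ e20)) => n [/= fn gn].
by rewrite [e]splitr; exact: dist_int_ltD.
Qed.

Lemma cvg0_mod1_0 (q : set_system posnat) : Filter q ->
  cvg0_mod1 q (fun=> 0).
Proof.
move=> Fq e e0; apply: filterS filterT => n _ /=.
by apply/dist_int_ltP; exists 0; rewrite subr0 normr0.
Qed.

Lemma cvg0_mod1_sum (q : set_system posnat) (I : eqType) (s : seq I)
    (f : I -> posnat -> R) : Filter q ->
  (forall i, i \in s -> cvg0_mod1 q (f i)) ->
  cvg0_mod1 q (fun n => \sum_(i <- s) f i n).
Proof.
move=> Fq; elim: s => [|i s IH] qf.
  under eq_fun do rewrite big_nil; exact: cvg0_mod1_0.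
under eq_fun do rewrite big_cons.
apply: cvg0_mod1D; first by apply: qf; rewrite mem_head.
by apply: IH => j js; apply: qf; rewrite in_cons js orbT.
Qed.

Lemma cvg20_mod1D (q : set_system posnat) (F G : posnat -> posnat -> R) :
  Filter q -> cvg20_mod1 q F -> cvg20_mod1 q G ->
  cvg20_mod1 q (fun n m => F n m + G n m).
Proof.
move=> Fq qF qG e e0; have e20 : 0 < e / 2 by lra.
apply: filterS (filterI (qF _ e20) (qG _ e20)) => n [/= Fn Gn].
apply: filterS (filterI Fn Gn) => m [/= Fm Gm].
by rewrite [e]splitr; exact: dist_int_ltD.
Qed.

Lemma cvg20_mod1_sum (q : set_system posnat) (k : nat)
    (F : 'I_k -> posnat -> posnat -> R) : Filter q ->
  (forall i, cvg20_mod1 q (F i)) ->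
  cvg20_mod1 q (fun n m => \sum_(i < k) F i n m).
Proof.
move=> Fq; elim: k F => [|k IH] F qF.
  move=> e e0; apply: filterS filterT => n _; apply: filterS filterT => m _ /=.
  by rewrite big_ord0; apply/dist_int_ltP; exists 0; rewrite subr0 normr0.
have -> : (fun n m => \sum_(i < k.+1) F i n m) =
    (fun n m => F ord0 n m + \sum_(i < k) F (lift ord0 i) n m).
  by apply/funext => n; apply/funext => m; rewrite big_ord_recl.
by apply: cvg20_mod1D => //; exact: IH.
Qed.

Lemma mod1_ultra_limit (q : set_system posnat) (f : posnat -> R) :
  UltraFilter q -> exists L : R, cvg0_mod1 q (fun n => f n - L).
Proof.
move=> Uq; have Pq := @ultra_proper _ _ Uq.
(* Fractional parts stay in the compact segment from 0 to 1 and agree with [f] modulo 1. *)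
pose g n : R := f n - (Num.floor (f n))%:~R.
have Ug : UltraFilter (g @ q) by exact: ultra_fmap.
have := @segment_compact R 0 1; rewrite compact_ultra => /(_ _ Ug) [|L [_ gL]].
  apply: (@filterS _ q _ setT (g @^-1` `[0, 1])) filterT => n _.
  rewrite /= in_itv /= /g.
  have := floor_le_tmp (f n); have := lt_succ_floor (f n).
  by rewrite intrD; lra.
exists L => e e0.
have /gL gLe : nbhs L (ball L e) by exact: nbhsx_ballx.
apply: (@filterS _ q _ (g @^-1` ball L e)) gLe => n; rewrite /= /ball /= distrC => gn.
by apply/dist_int_ltP; exists (Num.floor (f n)); rewrite addrAC.
Qed.

(** * Vanishing of odd monomials *)

(** This unfolds membership in [self_diff q]; the truncated subtraction is a true one for [q]-almost
    every [m], by freeness. *)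
Lemma cvg20_self_diff (q : set_system posnat) (f : nat -> R) :
  Filter q -> free_filter q ->
  cvg20_mod1 q (fun n m => f (val m - val n)%N) ->
  cvg0_mod1 (self_diff q) (fun n => f (val n)).
Proof.
move=> Fq fq qf e e0; apply: filterS (qf e e0) => n /= qn.
apply: filterS (filterI (fq (val n)) qn) => m [/posnat_ltP[d md] fm].
by exists d => //=; move: fm; rewrite /= md addKn.
Qed.

Lemma cvg20_mod1_eq (q : set_system posnat) (F G : posnat -> posnat -> R) :
  Filter q -> free_filter q ->
  (forall n m, (val n < val m)%N -> F n m = G n m) ->
  cvg20_mod1 q F -> cvg20_mod1 q G.
Proof.
move=> Fq fq FG qF e e0; apply: filterS (qF e e0) => n /= qn.
by apply: filterS (filterI (fq (val n)) qn) => m [/= /FG <-].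
Qed.

(** The coefficient ranges over all reals so that the induction can absorb a power of a fixed [n]
    into it. *)
Definition odd_monomials_vanish (q : set_system posnat) (l : nat) : Prop :=
  forall (c : R) (d : nat), odd d -> (d < l.*2)%N ->
    cvg0_mod1 q (fun n => c * (val n)%:R ^+ d).

Lemma cross_monomial_vanish (q : set_system posnat) (l i j : nat) (c : R) :
  UltraFilter q -> odd_monomials_vanish q l ->
  odd (i + j) -> (0 < i)%N -> (0 < j)%N -> (i + j < l.+1.*2)%N ->
  cvg20_mod1 q (fun n m => c * (val m)%:R ^+ i * (val n)%:R ^+ j).
Proof.
move=> Uq ql oij i0 j0 ijl; have Pq := @ultra_proper _ _ Uq.
have [oi|ei] := boolP (odd i).
  move=> e e0; apply: filterS filterT => n _ /=.
  have il : (i < l.*2)%N by lia.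
  have := ql (c * (val n)%:R ^+ j) i oi il e e0.
  by apply: filterS => m /=; rewrite mulrAC.
have oj : odd j by move: oij; rewrite oddD (negbTE ei).
have jl : (j < l.*2)%N by lia.
have [L qL] := mod1_ultra_limit q (fun m => c * (val m)%:R ^+ i) Uq.
move=> e e0; have e20 : 0 < e / 2 by lra.
apply: filterS (ql L j oj jl _ e20) => n /= Ln.
have nj0 : (0 < val n ^ j)%N by rewrite expn_gt0 (valP n).
(* With [n] fixed, multiplying by the integer [n ^ j] magnifies the error of the [m]-limit by at
   most that factor. *)
have en0 : 0 < e / 2 / (val n ^ j)%:R by rewrite divr_gt0// ltr0n.
apply: filterS (qL _ en0) => m /= /(dist_int_ltMn _ _ _ _ nj0) Lm.
have := dist_int_ltD _ _ _ _ _ Lm Ln; rewrite -splitr; congr (dist_int _ < e).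
by rewrite natrX; ring.
Qed.

Lemma odd_monomials_vanishS (q : set_system posnat) (l : nat) :
  UltraFilter q -> free_filter q ->
  odd_monomials_vanish q l -> odd_monomials_vanish (self_diff q) l.+1.
Proof.
move=> Uq fq ql c [//|d] od dl; have Pq := @ultra_proper _ _ Uq.
apply: (cvg20_self_diff q (fun n => c * n%:R ^+ d.+1)) => //.
(* [G i] is the binomial term of index [i.+1], so both exponents are positive. The terms of index 0
   and [d.+1] form [H], whose minus sign comes from the oddness of [d.+1]. *)
pose G (i : 'I_d) (n m : posnat) : R :=
  (c * (-1) ^+ i.+1 *+ 'C(d.+1, i.+1)) * (val m)%:R ^+ (d - i) * (val n)%:R ^+ i.+1.
pose H (n m : posnat) : R := c * (val m)%:R ^+ d.+1 - c * (val n)%:R ^+ d.+1.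
apply: (cvg20_mod1_eq q (fun n m => H n m + \sum_(i < d) G i n m)) => //.
  move=> n m nm; rewrite natrB 1?ltnW// exprBn big_ord_recl big_ord_recr /=.
  rewrite expr0 mul1r mulr1 bin0 mulr1n binn mulr1n subn0 subnn expr0 mulr1.
  rewrite -signr_odd od expr1 mulN1r /H.
  rewrite !mulrDr mulrN mulr_sumr [in RHS](addrC (\sum_(i < d) _)) addrA.
  congr (_ + _); apply: eq_bigr => i _.
  rewrite /G /bump /= add1n subSS.
  by rewrite mulrnAr !mulrnAl !mulrA.
apply: cvg20_mod1D; last first.
  apply: cvg20_mod1_sum => i.
  by apply: cross_monomial_vanish (ql) _ _ _ _ => //; have := ltn_ord i; lia.
have [L qL] := mod1_ultra_limit q (fun m => c * (val m)%:R ^+ d.+1) Uq.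
move=> e e0; have e20 : 0 < e / 2 by lra.
apply: filterS (qL _ e20) => n /= /dist_int_ltN Ln.
apply: filterS (qL _ e20) => m /= Lm.
have := dist_int_ltD _ _ _ _ _ Lm Ln; rewrite -splitr; congr (dist_int _ < e).
by rewrite /H; ring.
Qed.

Lemma iter_diff_odd_monomials_vanish (l : nat) (p : set_system posnat) :
  UltraFilter p -> free_filter p -> odd_monomials_vanish (iter_diff l p) l.
Proof.
(* The base case is vacuous: no degree is below 0. *)
move=> Up fp; elim: l => [//|l IH].
have [Uq fq] := iter_diff_ultra_free l p Up fp.
exact: odd_monomials_vanishS.
Qed.

Lemma iter_diff_odd_polynomial (l : nat) (a : nat -> R) (p : set_system posnat) :
  UltraFilter p -> free_filter p ->
  cvg0_mod1 (iter_diff l p) (fun n => (odd_polynomial l a).[(val n)%:R]).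
Proof.
move=> Up fp; have [Uq _] := iter_diff_ultra_free l p Up fp.
have Pq := @ultra_proper _ _ Uq.
under eq_fun do rewrite /odd_polynomial horner_sum.
apply: cvg0_mod1_sum => j; rewrite mem_index_iota => jl.
under eq_fun do rewrite hornerZ hornerXn.
by apply: iter_diff_odd_monomials_vanish => //; lia.
Qed.

(** Continuity of the projection pulls a neighbourhood in the circle back to a ball around 0 in R,
    and subtracting the nearby integer keeps the class. *)
Lemma cvg0_mod1_to_circle (q : set_system posnat) (f : posnat -> R) :
  Filter q -> cvg0_mod1 q f ->
  (fun n => to_circle (f n)) @ q --> to_circle (0 : R).
Proof.
move=> Fq qf U U0.
have : nbhs (0 : R) [set x | U (to_circle x)].
  exact: (@pi_continuous R (RmodZ R) 0 U U0).
move=> /nbhs_ballP[e /= e0 eU].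
apply: (@filterS _ q _ _ [set n | U (to_circle (f n))]) (qf e e0) => n /=.
move=> /dist_int_ltP[m fm].
have -> : to_circle (f n) = to_circle (f n - m%:~R).
  by apply/to_circleP; rewrite opprB addrC subrK intr_int.
by apply: eU; rewrite /ball /= sub0r normrN.
Qed.

End limits_mod1.

(** * Difference sets *)

(** The bound [K] is free in the induction so that the second half of the indices can be chosen
    beyond the first half. *)
Lemma iter_diff_sample (l : nat) (n : nat -> posnat) (u : set_system nat)
    (A : set posnat) (K : nat) :
  ProperFilter u -> (forall k, u [set i | (k < i)%N]) ->
  iter_diff l (n @ u) A ->
  exists k : seq nat, [/\ size k = (2 ^ l)%N, path ltn K k &
    exists2 e, A e & (val e)%:Z = partial_diff l [seq (val (n i))%:Z | i <- k]].
Proof.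
move=> Pu fu; elim: l A K => [|l IH] A K.
  move=> /= uA; have {}uA : u (n @^-1` A) by [].
  have [i [Ai /= Ki]] := filter_ex (filterI uA (fu K)).
  by exists [:: i]; split => //=; [rewrite Ki|exists (n i)].
rewrite /iter_diff /= => /(IH _ K) [k1 [sk1 pk1 [e1 Ae1 ee1]]].
(* The first half has difference [e1] with [translate e1 A] again large; the second half has
   difference [e3 = e1 + e2] in it, leaving [e2] in [A]. *)
have [k2 [sk2 pk2 [e3 [e2 Ae2 e32] ee2]]] := IH _ (last K k1) Ae1.
exists (k1 ++ k2); split.
- by rewrite size_cat sk1 sk2 expnS mul2n addnn.
- by rewrite cat_path pk1.
exists e2 => //=; rewrite map_cat drop_size_cat ?size_map//.
by rewrite take_size_cat ?size_map// -ee1 -ee2 e32 PoszD addrC addKr.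
Qed.

Theorem theorem3p2 (R : realType) (l : nat) (hl : (0 < l)%N) (a : nat -> R) :
  let v := odd_polynomial l a in
  (forall p : set_system posnat, UltraFilter p -> nonprincipal p ->
     (fun n : posnat => to_circle v.[(val n)%:R]) @ iter_diff l p
       --> to_circle (0 : R))
  /\
  (forall eps : R, 0 < eps ->
     Delta_star l [set n : posnat | dist_int v.[(val n)%:R] < eps]).
Proof.
move=> v; split=> [p Up np|eps eps0 n n_incr].
  have fp := nonprincipal_free p Up np.
  have [Uq _] := iter_diff_ultra_free l p Up fp.
  have Pq := @ultra_proper _ _ Uq.
  by apply: cvg0_mod1_to_circle; exact: iter_diff_odd_polynomial.
have [u [Uu ou]] := ultraFilterLemma (@eventually_filter).
have Pu := @ultra_proper _ _ Uu.
have fu k : u [set i | (k < i)%N] by apply: ou; exists k.+1.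
(* This growth makes the image of [u] under [n] free. *)
have n_ge i : (i <= val (n i))%N.
  by elim: i => // i IH; apply: leq_ltn_trans IH (n_incr _ _ (ltnSn i)).
have Up := ultra_fmap _ _ n _ Uu.
have fp : free_filter (n @ u).
  move=> K; apply: (@filterS _ u _ _ [set i | (K < val (n i))%N]) (fu K) => i Ki.
  exact: leq_trans Ki (n_ge i).
have [k [/eqP sk pk Ek]] := iter_diff_sample l n u _ 0%N Pu fu
  (iter_diff_odd_polynomial R l a _ Up fp eps eps0).
by exists (Tuple sk); split => //=; exact: path_sorted pk.
Qed.
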